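(* Let $(A,\succ,\prec)$ be a pre-left-Alia algebra, let $\{e_1,\dots,e_n\}$ be a basis of $A$ and $\{e_1^*,\dots,e_n^*\}$ the dual basis of $A^*$. Then $$r=\sum_{i=1}^n\big(e_i^*\otimes e_i-e_i\otimes e_i^*\big)$$ is an antisymmetric solution of the left-Alia Yang-Baxter equation in the left-Alia algebra $A\ltimes_{\mathcal L_\succ^*,\,\mathcal L_\succ^*-\mathcal R_\prec^*}A^*$.
   Context: All vector spaces are finite-dimensional over an algebraically closed field $\mathbb K$ of characteristic zero. A left-Alia algebra is a vector space $A$ with a bilinear map $[\cdot,\cdot]:A\times A\to A$ (not assumed antisymmetric) such that for all $x,y,z\in A$ $$[[x,y],z]+[[y,z],x]+[[z,x],y]=[[y,x],z]+[[z,y],x]+[[x,z],y].$$ A pre-left-Alia algebra is a triple $(A,\succ,\prec)$ where $A$ is a vector space and $\succ,\prec:A\otimes A\to A$ are bilinear multiplications such that for all $x,y,z\in A$ $$(x\succ y+x\prec y)\succ z-(y\succ x+y\prec x)\succ z+(y\succ z-z\prec y)\prec x+(z\prec x-x\succ z)\prec y=0.$$ Its sub-adjacent left-Alia algebra is $(A,[\cdot,\cdot])$ with $[x,y]=x\succ y+x\prec y$. Define $\mathcal L_\succ,\mathcal R_\prec:A\to\mathrm{End}(A)$ by $\mathcal L_\succ(x)y=x\succ y$ and $\mathcal R_\prec(x)y=y\prec x$. For a linear map $l:A\to\mathrm{End}(V)$, $l^*:A\to\mathrm{End}(V^* )$ is defined by $\langle l^*(x)u^*,v\rangle=-\langle u^*,l(x)v\rangle$.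 $A\ltimes_{\mathcal L_\succ^*,\mathcal L_\succ^*-\mathcal R_\prec^*}A^*$ denotes the left-Alia algebra on $A\oplus A^*$ with bracket $$[x+a^*,y+b^*]_d=[x,y]+\mathcal L_\succ^*(x)b^*+(\mathcal L_\succ^*-\mathcal R_\prec^* )(y)a^*,\qquad x,y\in A,\ a^*,b^*\in A^*,$$ where $[x,y]=x\succ y+x\prec y$. For a left-Alia algebra $(B,[\cdot,\cdot])$ and $s=\sum_i u_i\otimes v_i\in B\otimes B$, put $$\mathrm{Al}(s)=\sum_{i,j}\Big([u_i,u_j]\otimes v_i\otimes v_j+u_i\otimes([u_j,v_i]-[v_i,u_j])\otimes v_j-u_i\otimes u_j\otimes[v_j,v_i]\Big)\in B^{\otimes 3}.$$ $s$ is a solution of the left-Alia Yang-Baxter equation in $B$ if $\mathrm{Al}(s)=0$, and antisymmetric if $s+\tau(s)=0$, where $\tau(x\otimes y)=y\otimes x$. *)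

(* Defs.v *)
From HB Require Import structures.
From mathcomp Require Import all_boot all_order all_algebra.
From mathcomp Require Import ring.

Set Implicit Arguments.
Unset Strict Implicit.
Unset Printing Implicit Defensive.

Import GRing.Theory.
Local Open Scope ring_scope.

Notation dual V := 'Hom(V, _^o).
Notation is_bilinear f := (bilinear_for *:%R *:%R f).

Section Tensor.
Variable K : fieldType.
Implicit Types U V W X : vectType K.

(* All spaces are finite dimensional, so V (x) W is modelled by Hom(V^*, W),
   with v (x) w the map f |-> f(v) w.  The universal property is
   tensor_liftE and tensor_ext below. *)
Definition tensor V W : vectType K := 'Hom(dual V, W).

Definition tens V W (v : V) (w : W) : tensor V W :=
  linfun (fun f : dual V => f v *: w).

Definition vcoord V (i : 'I_(\dim {:V})) : dual V :=
  linfun (coord (vbasis {:V}) i : V -> K^o).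

(* The linear map sending v (x) w to f v w, for f bilinear. *)
Definition tensor_lift V W U (f : V -> W -> U) : 'Hom(tensor V W, U) :=
  linfun (fun s : 'Hom(dual V, W) => \sum_(i < \dim {:V}) f (vbasis {:V})`_i (s (vcoord i))).

Definition tau V W : 'Hom(tensor V W, tensor W V) :=
  tensor_lift (fun v w => tens w v).

End Tensor.

Section LinearFacts.
Variable K : fieldType.
Implicit Types U V W X : vectType K.

Lemma tensE V W (v : V) (w : W) (f : dual V) :
  (tens v w : 'Hom(dual V, W)) f = f v *: w.
Proof.
pose g := fun f : dual V => f v *: w.
have lin_g : linear g.
  by move=> a h k; rewrite /g !lfunE /= lfunE /= scalerDl scalerA.
pose gM := GRing.isLinear.Build K (dual V) W _ g lin_g.
pose gL : {linear _ -> _} := HB.pack g gM.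
exact: (lfunE gL f).
Qed.

Lemma tens_bilinear V W : is_bilinear (@tens K V W).
Proof.
split=> [w a v1 v2|v a w1 w2]; apply/lfunP => f.
  rewrite tensE add_lfunE scale_lfunE !tensE linearP.
  by rewrite scalerDl scalerA.
by rewrite add_lfunE scale_lfunE !tensE scalerDr !scalerA [f v * a]mulrC.
Qed.

Lemma vcoordE V (i : 'I_(\dim {:V})) v :
  vcoord i v = coord (vbasis {:V}) i v.
Proof. by rewrite /vcoord lfunE. Qed.

Lemma vcoord_sum V (v : V) : v = \sum_(i < \dim {:V}) vcoord i v *: (vbasis {:V})`_i.
Proof.
rewrite {1}(coord_vbasis (memvf v)).
by apply: eq_bigr => i _; rewrite vcoordE.
Qed.

Lemma tensor_decomp V W (s : tensor V W) :
  s = \sum_(i < \dim {:V}) tens (vbasis {:V})`_i ((s : 'Hom(dual V, W)) (vcoord i)).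
Proof.
apply/lfunP => f; rewrite sum_lfunE.
have -> : f = \sum_(i < \dim {:V}) f (vbasis {:V})`_i *: vcoord i.
  apply/lfunP => v; rewrite {1}(vcoord_sum v) linear_sum sum_lfunE.
  by apply: eq_bigr => i _; rewrite linearZ scale_lfunE /= [LHS]mulrC.
rewrite linear_sum; apply: eq_bigr => i _ /=.
rewrite tensE linearZ /= sum_lfunE; congr (_ *: _).
rewrite (bigD1 i) //= big1 ?addr0 => [|j ji]; last first.
  rewrite scale_lfunE vcoordE coord_free ?(basis_free (vbasisP _)) //.
  by rewrite eq_sym (negPf ji) scaler0.
rewrite scale_lfunE vcoordE coord_free ?(basis_free (vbasisP _)) // eqxx.
by rewrite [RHS]mulr1.
Qed.

Lemma tensor_liftE V W U (f : V -> W -> U) : is_bilinear f ->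
  forall v w, tensor_lift f (tens v w) = f v w.
Proof.
move=> [f1 f2] v w.
pose g := fun s : 'Hom(dual V, W) => \sum_(i < \dim {:V}) f (vbasis {:V})`_i (s (vcoord i)).
have lin_g : linear g.
  move=> a s t; rewrite /g scaler_sumr -big_split; apply: eq_bigr => i _ /=.
  by rewrite add_lfunE scale_lfunE f2.
pose gM := GRing.isLinear.Build K 'Hom(dual V, W) U _ g lin_g.
pose gL : {linear _ -> _} := HB.pack g gM.
have -> : tensor_lift f (tens v w) = g (tens v w) by exact: (lfunE gL).
pose h := f^~ w.
pose hM := GRing.isLinear.Build K V U _ h (f1 w).
pose hL : {linear _ -> _} := HB.pack h hM.
have -> : f v w = hL v by [].
rewrite [in RHS](vcoord_sum v) linear_sum /g; apply: eq_bigr => i _.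
by rewrite tensE linearZ /=; apply: (scalable_linear (f2 _)).
Qed.

Lemma tensor_ext V W U (f g : 'Hom(tensor V W, U)) :
  (forall v w, f (tens v w) = g (tens v w)) -> f = g.
Proof.
move=> fg; apply/lfunP => s; rewrite (tensor_decomp s) !linear_sum.
by apply: eq_bigr => i _; apply: fg.
Qed.

Lemma tauE V W (v : V) (w : W) : tau V W (tens v w) = tens w v.
Proof.
rewrite /tau tensor_liftE //; have [t1 t2] := tens_bilinear W V.
by split=> [u|u]; [apply: t2 | apply: t1].
Qed.

End LinearFacts.

Section Alia.
Variable K : fieldType.
Implicit Types A B V : vectType K.

Definition left_alia_axiom B (br : B -> B -> B) := forall x y z,
  br (br x y) z + br (br y z) x + br (br z x) y =
  br (br y x) z + br (br z y) x + br (br x z) y.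

Record leftAlia B := LeftAlia {
  alia_br :> {bilinear B -> B -> B};
  alia_brP : left_alia_axiom alia_br
}.

Definition pre_left_alia_axiom A (s p : A -> A -> A) := forall x y z,
  s (s x y + p x y) z - s (s y x + p y x) z
  + p (s y z - p z y) x + p (p z x - s x z) y = 0.

Record preLeftAlia A := PreLeftAlia {
  pre_succ : {bilinear A -> A -> A};
  pre_prec : {bilinear A -> A -> A};
  preP : pre_left_alia_axiom pre_succ pre_prec
}.

(* The outer lift ranges over u_i (x) v_i = u (x) v, the inner one over
   u_j (x) v_j = u' (x) v'; the expanded formula is AlE below. *)
Definition Al_summand B (br : B -> B -> B) (u v u' v' : B) :
    tensor B (tensor B B) :=
  tens (br u u') (tens v v')
  + tens u (tens (br u' v - br v u') v')
  - tens u (tens u' (br v' v)).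

Definition Al B (br : leftAlia B) (s : tensor B B) : tensor B (tensor B B) :=
  tensor_lift (fun u v => tensor_lift (Al_summand br u v)) s s.

Definition left_alia_YBE B (br : leftAlia B) (s : tensor B B) := Al br s = 0.

Definition antisymmetric_tensor B (s : tensor B B) := s + tau B B s = 0.

(* <l^*(x) u, v> = - <u, l(x) v> *)
Definition dual_act A V (l : A -> 'End(V)) (x : A) : 'End(dual V) :=
  linfun (fun u : dual V => - (u \o l x)%VF).

Section Semidirect.
Variables (A : vectType K) (P : preLeftAlia A).
Local Notation "x ≻ y" := (pre_succ P x y) (at level 40).
Local Notation "x ≺ y" := (pre_prec P x y) (at level 40).

Definition sub_br (x y : A) : A := x ≻ y + x ≺ y.

Definition Lsucc (x : A) : 'End(A) := linfun (fun y => x ≻ y).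
Definition Rprec (x : A) : 'End(A) := linfun (fun y => y ≺ x).

Definition semidirect_br (p q : A * dual A) : A * dual A :=
  let: (x, a) := p in let: (y, b) := q in
  (sub_br x y,
   dual_act Lsucc x b + (dual_act Lsucc y - dual_act Rprec y) a).

End Semidirect.

End Alia.

(* Scalar bookkeeping for sub_br_alia and semidirect_alia below. *)
Section Scalar.
Variables (K : fieldType) (T D : Type).

Lemma sub_br_scalar (s ps pp : T -> T -> T -> K) (x y z : T)
    (E := fun x y z => s x y z - s y x z
      + (ps y z x - pp z y x) + (pp z x y - ps x z y)) :
  E x y z = 0 -> E y z x = 0 -> E z x y = 0 ->
  s x y z + (ps x y z + pp x y z) + (s y z x + (ps y z x + pp y z x))
  + (s z x y + (ps z x y + pp z x y)) =
  s y x z + (ps y x z + pp y x z) + (s z y x + (ps z y x + pp z y x))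
  + (s x z y + (ps x z y + pp x z y)).
Proof.
move=> E1 E2 E3; apply: subr0_eq; transitivity (E x y z + E y z x + E z x y).
  by rewrite /E; ring.
by rewrite E1 E2 E3 !addr0.
Qed.

Lemma semidirect_scalar (s ps pp ss sp : D -> T -> T -> K) x y z a b c
    (E := fun c x y => s c x y - s c y x
      + (ps c y x - pp c y x) + (pp c x y - ps c x y))
    (F := fun x y z a b c => - s c x y
      + (- (- ss b x z + (- ss a y z + ps a z y))
         + (- sp b x z + (- sp a y z + pp a z y)))) :
  E c x y = 0 -> E a y z = 0 -> E b z x = 0 ->
  F x y z a b c + F y z x b c a + F z x y c a b =
  F y x z b a c + F z y x c b a + F x z y a c b.
Proof.
move=> E1 E2 E3; apply: subr0_eq; transitivity (- (E c x y + E a y z + E b z x)).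
  by rewrite /E /F; ring.
by rewrite E1 E2 E3 !addr0 oppr0.
Qed.

Lemma semidirect_lin (k s ss p s' ss' p' : K) :
  - (k * s + s') + (- (k * ss + ss') + (k * p + p')) =
  k * (- s + (- ss + p)) + (- s' + (- ss' + p')).
Proof. by ring. Qed.

End Scalar.

Section AliaFacts.
Variable K : fieldType.
Implicit Types A B U V W : vectType K.

Let tensl V W a (v v' : V) (w : W) :
  tens (a *: v + v') w = a *: tens v w + tens v' w.
Proof. exact: (@tens_bilinear K V W).1. Qed.

Let tensr V W a (v : V) (w w' : W) :
  tens v (a *: w + w') = a *: tens v w + tens v w'.
Proof. exact: (@tens_bilinear K V W).2. Qed.

Let bilinD U V W (f g : U -> V -> W) : is_bilinear f -> is_bilinear g ->
  is_bilinear (fun x y => f x y + g x y).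
Proof.
move=> [f1 f2] [g1 g2]; split=> x a y z /=; first by rewrite f1 g1 scalerDr addrACA.
by rewrite f2 g2 scalerDr addrACA.
Qed.

Let bilinN U V W (f : U -> V -> W) : is_bilinear f ->
  is_bilinear (fun x y => - f x y).
Proof.
by move=> [f1 f2]; split=> x a y z /=; rewrite (f1, f2) opprD scalerN.
Qed.

Let subP B (br : {bilinear B -> B -> B}) a x x' y :
  br (a *: x + x') y - br y (a *: x + x') =
  a *: (br x y - br y x) + (br x' y - br y x').
Proof. by rewrite linearPl linearPr opprD addrACA scalerBr. Qed.

Lemma Al_summand_bilinr B (br : leftAlia B) (u v : B) :
  is_bilinear (Al_summand br u v).
Proof.
apply: bilinD; first apply: bilinD; last apply: bilinN.
- by split=> x a y z /=; rewrite ?linearPr ?tensl ?tensr ?tensl.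
- by split=> x a y z /=; rewrite ?subP ?tensl ?tensr ?tensl ?tensr.
- by split=> x a y z /=; rewrite ?linearPl ?tensl ?tensr ?tensl ?tensr.
Qed.

Lemma Al_summand_bilinl B (br : leftAlia B) (u' v' : B) :
  is_bilinear (fun u v => Al_summand br u v u' v').
Proof.
have brN x y : br x y - br y x = - (br y x - br x y) by rewrite opprB.
apply: bilinD; first apply: bilinD; last apply: bilinN.
- by split=> x a y z /=; rewrite ?linearPl ?tensl ?tensr ?tensl ?tensr.
- split=> x a y z /=; first by rewrite tensl.
  by rewrite brN subP opprD -scalerN -!brN tensl tensr.
- by split=> x a y z /=; rewrite ?linearPr ?tensl ?tensr ?tensl ?tensr.
Qed.

Lemma AlE B (br : leftAlia B) n (u v : 'I_n -> B) :
  Al br (\sum_i tens (u i) (v i)) =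
  \sum_i \sum_j
    (tens (br (u i) (u j)) (tens (v i) (v j))
     + tens (u i) (tens (br (u j) (v i) - br (v i) (u j)) (v j))
     - tens (u i) (tens (u j) (br (v j) (v i)))).
Proof.
have lf x y := tensor_liftE (Al_summand_bilinr br x y).
have bl : is_bilinear (fun u v => tensor_lift (Al_summand br u v)).
  have [b1 b2] := (fun x y => (Al_summand_bilinl br x y).1,
                   fun x y => (Al_summand_bilinl br x y).2).
  split=> x a y z /=; apply: tensor_ext => u' v';
    rewrite add_lfunE scale_lfunE !lf; first exact: b1.
  exact: b2.
rewrite /Al linear_sum exchange_big; apply: eq_bigr => j _ /=.
rewrite linear_sum sum_lfunE; apply: eq_bigr => i _ /=.
by rewrite tensor_liftE //; apply: lf.
Qed.

Lemma dual_actE A V (l : A -> 'End(V)) x (u : dual V) v :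
  dual_act l x u v = - u (l x v).
Proof.
pose g := fun u : dual V => - (u \o l x)%VF.
have lin_g : linear g.
  by move=> a f h; rewrite /g comp_lfunDl -comp_lfunZl opprD scalerN.
pose gM := GRing.isLinear.Build K (dual V) (dual V) _ g lin_g.
pose gL : {linear _ -> _} := HB.pack g gM.
have -> : dual_act l x u = g u by exact: (lfunE gL u).
by rewrite opp_lfunE comp_lfunE.
Qed.

Lemma LsuccE A (P : preLeftAlia A) x y : Lsucc P x y = pre_succ P x y.
Proof. by rewrite /Lsucc lfunE. Qed.

Lemma RprecE A (P : preLeftAlia A) x y : Rprec P x y = pre_prec P y x.
Proof. exact: (lfunE (applyr (pre_prec P) x)). Qed.

Section SemidirectFacts.
Variables (A : vectType K) (P : preLeftAlia A).

Let semidirect_sndE p q v : (semidirect_br P p q).2 v =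
  - q.2 (pre_succ P p.1 v) + (- p.2 (pre_succ P q.1 v) + p.2 (pre_prec P v q.1)).
Proof.
case: p q => [x a] [y b] /=.
by rewrite !(add_lfunE, opp_lfunE, dual_actE, LsuccE, RprecE) opprK.
Qed.

Let semidirect_fstE p q : (semidirect_br P p q).1 = sub_br P p.1 q.1.
Proof. by case: p q => [x a] [y b]. Qed.

Let sndD (p q : A * dual A) v : (p + q).2 v = p.2 v + q.2 v.
Proof. exact: add_lfunE. Qed.

Lemma semidirect_bilinear : is_bilinear (semidirect_br P).
Proof.
have sndP k (p q : A * dual A) v : (k *: p + q).2 v = k *: p.2 v + q.2 v.
  by rewrite sndD scale_lfunE.
have fP (f : dual A) k u w : f (k *: u + w) = k *: f u + f w by apply: linearP.
have fstP k (p q : A * dual A) : (k *: p + q).1 = k *: p.1 + q.1 by [].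
split=> [r k p q|p k q r]; apply: injective_projections.
- by rewrite fstP !semidirect_fstE fstP /sub_br !linearPl scalerDr addrACA.
- apply/lfunP => v; rewrite sndP !semidirect_sndE fstP linearPl fP !sndP.
  exact: semidirect_lin.
- by rewrite fstP !semidirect_fstE fstP /sub_br !linearPr scalerDr addrACA.
- apply/lfunP => v; rewrite sndP !semidirect_sndE fstP linearPl linearPr !fP sndP.
  exact: semidirect_lin.
Qed.

HB.instance Definition _ := bilinear_isBilinear.Build K
  (A * dual A)%type (A * dual A)%type (A * dual A)%type *:%R *:%R
  (semidirect_br P) semidirect_bilinear.

Let dual_ext (u w : A) : (forall f : dual A, f u = f w) -> u = w.
Proof.
move=> uw; rewrite (vcoord_sum u) (vcoord_sum w).
by apply: eq_bigr => i _; rewrite uw.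
Qed.

Let preP_dual (c : dual A) x y v :
  c (pre_succ P (sub_br P x y) v) - c (pre_succ P (sub_br P y x) v)
  + (c (pre_prec P (pre_succ P y v) x) - c (pre_prec P (pre_prec P v y) x))
  + (c (pre_prec P (pre_prec P v x) y) - c (pre_prec P (pre_succ P x v) y)) = 0.
Proof.
rewrite -(raddf0 c) -[in RHS](preP P x y v) !linearBl.
by rewrite !raddfD !raddfN.
Qed.

Let sub_brE (f : dual A) x y z : f (sub_br P (sub_br P x y) z) =
  f (pre_succ P (sub_br P x y) z)
  + (f (pre_prec P (pre_succ P x y) z) + f (pre_prec P (pre_prec P x y) z)).
Proof. by rewrite -raddfD -linearDl -raddfD. Qed.

Lemma sub_br_alia : left_alia_axiom (sub_br P).
Proof.
move=> x y z; apply: dual_ext => f.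
have fD u v w : f (u + v + w) = f u + f v + f w by rewrite !raddfD.
rewrite 2!fD !sub_brE.
exact: (sub_br_scalar (s := fun x y z => f (pre_succ P (sub_br P x y) z))
  (ps := fun x y z => f (pre_prec P (pre_succ P x y) z))
  (pp := fun x y z => f (pre_prec P (pre_prec P x y) z))
  (preP_dual f x y z) (preP_dual f y z x) (preP_dual f z x y)).
Qed.

Lemma semidirect_alia : left_alia_axiom (semidirect_br P).
Proof.
move=> [x a] [y b] [z c]; apply: injective_projections.
  exact: sub_br_alia.
apply/lfunP => v; rewrite !sndD !semidirect_sndE !semidirect_fstE /fst /snd.
exact: (@semidirect_scalar K A (dual A)
  (fun c x y => (c : dual A) (pre_succ P (sub_br P x y) v))
  (fun c x y => (c : dual A) (pre_prec P (pre_succ P x v) y))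
  (fun c x y => (c : dual A) (pre_prec P (pre_prec P v x) y))
  (fun c x y => (c : dual A) (pre_succ P x (pre_succ P y v)))
  (fun c x y => (c : dual A) (pre_succ P x (pre_prec P v y)))
  _ _ _ _ _ _ (preP_dual c x y v) (preP_dual a y z v) (preP_dual b z x v)).
Qed.

Definition semidirect : leftAlia (A * dual A)%type :=
  LeftAlia semidirect_alia.

Lemma semidirectE x y (a b : dual A) : semidirect (x, a) (y, b) =
  (pre_succ P x y + pre_prec P x y,
   dual_act (Lsucc P) x b
   + (dual_act (Lsucc P) y - dual_act (Rprec P) y) a).
Proof. by []. Qed.

End SemidirectFacts.

End AliaFacts.

(* Main.v *)
Require Import Defs.
From HB Require Import structures.
From mathcomp Require Import all_boot all_order all_algebra.
Import GRing.Theory.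
Local Open Scope ring_scope.

(** The canonical tensor sum_i e_i^* (x) e_i represents the identity of A, so
    an endomorphism g of A may be moved from one leg to the other:
      sum_i (e_i^* o g) (x) e_i = sum_i e_i^* (x) g(e_i)
    (canonical_tensor_adjoint, and transpose_sum after a bilinear map).  This
    and the values of the bracket on the two summands are all that the
    Yang-Baxter equation takes.

    Antisymmetry holds term by term.  For the equation, A^* A^* brackets to 0
    and brackets with exactly one factor in A^* land in A^*, so every nonzero
    term of Al(r) has two legs in A^* and one in A (Al_skew_canonical).  The
    three positions of the leg in A are treated separately.  In each of them,
    transposing every L or R that acts on some e_i^* back to the leg in A
    turns the component, up to the order of the legs, into
      sum_(i,j) e_i^* (x) e_j^* (x) c_ij    with c_ij in A,
    and c_ij vanishes identically:
    - A^* A^* A:  e_j ≺ e_i - (e_j ≻ e_i + e_j ≺ e_i) + e_j ≻ e_i = 0;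
    - A^* A A^*:  - (e_i ≺ e_j - e_j ≻ e_i) + [e_i, e_j] - [e_j, e_i]
                  + (e_j ≺ e_i - e_i ≻ e_j) = 0;
    - A A^* A^*:  [e_i, e_j] - e_i ≺ e_j - e_i ≻ e_j = 0.

    The computation only sees the four brackets, so it is done in any
    left-Alia algebra B receiving linear maps from A and A^* with the right
    brackets, and then specialised to the semidirect product. *)

Set Implicit Arguments.
Unset Strict Implicit.

(** * Bilinearity of the tensor product *)

HB.instance Definition _ (K : fieldType) (V W : vectType K) :=
  bilinear_isBilinear.Build K V W (tensor V W) *:%R *:%R (@tens K V W)
    (@tens_bilinear K V W).

Lemma tensNl (K : fieldType) (V W : vectType K) (v : V) (w : W) :
  tens (- v) w = - tens v w.
Proof. exact: linearNl. Qed.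

Lemma tensNr (K : fieldType) (V W : vectType K) (v : V) (w : W) :
  tens v (- w) = - tens v w.
Proof. exact: linearNr. Qed.

Lemma tens0l (K : fieldType) (V W : vectType K) (w : W) :
  tens (0 : V) w = 0.
Proof. exact: linear0l. Qed.

Lemma tens0r (K : fieldType) (V W : vectType K) (v : V) :
  tens v (0 : W) = 0.
Proof. exact: linear0r. Qed.

Lemma tensDl (K : fieldType) (V W : vectType K) (v v' : V) (w : W) :
  tens (v + v') w = tens v w + tens v' w.
Proof. exact: linearDl. Qed.

Lemma tensDr (K : fieldType) (V W : vectType K) (v : V) (w w' : W) :
  tens v (w + w') = tens v w + tens v w'.
Proof. exact: linearDr. Qed.

(** * Dual bases and transposition *)

Section Transpose.
Variables (K : fieldType) (A : vectType K) (n : nat).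
Variables (e : n.-tuple A) (e_basis : basis_of {:A} e) (e' : n.-tuple (dual A)).
Hypothesis e'_dual : forall i j : 'I_n, tnth e' i (tnth e j) = (i == j)%:R.

Lemma dual_basis_expand (x : A) : x = \sum_i tnth e' i x *: tnth e i.
Proof.
have xE := coord_basis e_basis (memvf x); rewrite {1}xE.
apply: eq_bigr => i _; rewrite -tnth_nth; congr (_ *: _).
rewrite [in RHS]xE linear_sum (bigD1 i) //= big1 => [|j /negPf ji].
  by rewrite -tnth_nth linearZ /= e'_dual eqxx addr0 [RHS]mulr1.
by rewrite -tnth_nth linearZ /= e'_dual eq_sym ji [LHS]mulr0.
Qed.

Lemma dual_expand (f : dual A) : f = \sum_i f (tnth e i) *: tnth e' i.
Proof.
apply/lfunP => x; rewrite {1}(dual_basis_expand x) linear_sum sum_lfunE.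
by apply: eq_bigr => i _; rewrite linearZ scale_lfunE /= [LHS]mulrC.
Qed.

(** Both sides expand to the sum of e_i^*(g e_k) (e_k^* (x) e_i) over i and k:
    the left by expanding e_i^* o g, the right by expanding g(e_k). *)
Lemma canonical_tensor_adjoint (g : 'End(A)) :
  \sum_i tens (tnth e' i \o g)%VF (tnth e i) =
  \sum_i tens (tnth e' i) (g (tnth e i)).
Proof.
under eq_bigr => i _ do rewrite [(_ \o g)%VF]dual_expand linear_sumlz.
rewrite exchange_big; apply: eq_bigr => k _.
rewrite [in RHS](dual_basis_expand (g (tnth e k))) linear_sumr.
by apply: eq_bigr => i _; rewrite linearZl_LR linearZr_LR comp_lfunE.
Qed.

Lemma transpose_sum (U : vectType K) (F : dual A -> A -> U) (g : 'End(A)) :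
  is_bilinear F ->
  \sum_i F (tnth e' i \o g)%VF (tnth e i) = \sum_i F (tnth e' i) (g (tnth e i)).
Proof.
move=> /tensor_liftE liftE; under eq_bigr => i _ do rewrite -liftE.
rewrite -linear_sum canonical_tensor_adjoint linear_sum.
by apply: eq_bigr => i _; apply: liftE.
Qed.

End Transpose.

(** * Double sums *)

(** Summation over two copies of an index set, used to write a sum of
    differences of pure tensors as a single family of pure tensors. *)
Lemma double_sum_split (V : nmodType) n (F : 'I_(n + n) -> 'I_(n + n) -> V) :
  \sum_i \sum_j F i j =
  \sum_(i < n) \sum_(j < n)
    ((F (lshift n i) (lshift n j) + F (lshift n i) (rshift n j))
     + (F (rshift n i) (lshift n j) + F (rshift n i) (rshift n j))).
Proof.
rewrite big_split_ord /= -big_split; apply: eq_bigr => i _ /=.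
by rewrite !big_split_ord /= -!big_split.
Qed.

Lemma double_sumD3 (V : nmodType) (I : finType) (F G H : I -> I -> V) :
  \sum_i \sum_j (F i j + G i j + H i j) =
  \sum_i \sum_j F i j + \sum_i \sum_j G i j + \sum_i \sum_j H i j.
Proof.
by rewrite -!big_split; apply: eq_bigr => i _; rewrite /= -!big_split.
Qed.

(** Each family may be reindexed or transposed inside its own double sum; the
    cancellation is then checked termwise. *)
Lemma double_sum_eq0 (V : nmodType) (I : finType)
    (F G H F' G' H' : I -> I -> V) :
    \sum_i \sum_j F i j = \sum_i \sum_j F' i j ->
    \sum_i \sum_j G i j = \sum_i \sum_j G' i j ->
    \sum_i \sum_j H i j = \sum_i \sum_j H' i j ->
    (forall i j, F' i j + G' i j + H' i j = 0) ->
  \sum_i \sum_j (F i j + G i j + H i j) = 0.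
Proof.
move=> FF' GG' HH' sum0.
rewrite double_sumD3 FF' GG' HH' -double_sumD3 big1 // => i _.
by rewrite big1 // => j _; apply: sum0.
Qed.

(** * The skew canonical tensor *)

Section Solution.
Variables (K : fieldType) (A : vectType K) (P : preLeftAlia A) (n : nat).
Variables (e : n.-tuple A) (e_basis : basis_of {:A} e) (e' : n.-tuple (dual A)).
Hypothesis e'_dual : forall i j : 'I_n, tnth e' i (tnth e j) = (i == j)%:R.

Variables (B : vectType K) (br : leftAlia B).
Variables (iA : {linear A -> B}) (iD : {linear dual A -> B}).
Local Notation "x ≻ y" := (pre_succ P x y) (at level 40).
Local Notation "x ≺ y" := (pre_prec P x y) (at level 40).
Local Notation ee i := (tnth e i).
Local Notation ee' i := (tnth e' i).

Hypothesis br_base_base : forall x y, br (iA x) (iA y) = iA (x ≻ y + x ≺ y).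
Hypothesis br_base_dual : forall x f,
  br (iA x) (iD f) = - iD (f \o Lsucc P x)%VF.
Hypothesis br_dual_base : forall f y,
  br (iD f) (iA y) = iD (f \o (Rprec P y - Lsucc P y))%VF.
Hypothesis br_dual_dual : forall f g, br (iD f) (iD g) = 0.

(* The contributions of L cancel, which leaves R alone. *)
Let br_commutator f y :
  br (iD f) (iA y) - br (iA y) (iD f) = iD (f \o Rprec P y)%VF.
Proof.
by rewrite br_dual_base br_base_dual opprK -linearD -comp_lfunDr subrK.
Qed.

Definition tens3 (x y z : B) : tensor B (tensor B B) := tens x (tens y z).

Definition skew_canonical : tensor B B :=
  \sum_(i < n) (tens (iD (ee' i)) (iA (ee i)) - tens (iA (ee i)) (iD (ee' i))).

Lemma skew_canonical_antisymmetric : antisymmetric_tensor skew_canonical.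
Proof.
rewrite /antisymmetric_tensor linear_sum -big_split big1 // => i _ /=.
by rewrite (linearB (tau B B)) /= !tauE addrA subrK subrr.
Qed.

(** The three families below collect the terms of Al of the skew canonical
    tensor according to the position of the leg in A, with each bracket
    evaluated; i and j are the indices of the two copies of the tensor. *)
Definition dual_dual_base i j :=
  tens3 (iD (ee' i)) (iD (ee' j \o Rprec P (ee i))%VF) (iA (ee j))
  - tens3 (iD (ee' i)) (iD (ee' j)) (iA (ee j ≻ ee i + ee j ≺ ee i))
  + tens3 (iD (ee' j \o Lsucc P (ee i))%VF) (iD (ee' i)) (iA (ee j)).

Definition dual_base_dual i j :=
  - tens3 (iD (ee' i \o (Rprec P (ee j) - Lsucc P (ee j)))%VF)
      (iA (ee i)) (iD (ee' j))
  + tens3 (iD (ee' i))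
      (iA ((ee i ≻ ee j + ee i ≺ ee j) - (ee j ≻ ee i + ee j ≺ ee i)))
      (iD (ee' j))
  + tens3 (iD (ee' i)) (iA (ee j))
      (iD (ee' j \o (Rprec P (ee i) - Lsucc P (ee i)))%VF).

Definition base_dual_dual i j :=
  tens3 (iA (ee i ≻ ee j + ee i ≺ ee j)) (iD (ee' i)) (iD (ee' j))
  - tens3 (iA (ee i)) (iD (ee' i \o Rprec P (ee j))%VF) (iD (ee' j))
  - tens3 (iA (ee i)) (iD (ee' j)) (iD (ee' i \o Lsucc P (ee j))%VF).

Lemma Al_skew_canonical : Al br skew_canonical =
  \sum_i \sum_j dual_dual_base i j + \sum_i \sum_j dual_base_dual i j
  + \sum_i \sum_j base_dual_dual i j.
Proof.
(* The tensor as one family of 2n pure tensors: e_i^* (x) e_i in the first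
   half, the opposites of e_i (x) e_i^* in the second. *)
pose u (k : 'I_(n + n)) :=
  match split k with inl i => iD (ee' i) | inr i => iA (ee i) end.
pose v (k : 'I_(n + n)) :=
  match split k with inl i => iA (ee i) | inr i => - iD (ee' i) end.
have ul i : u (lshift n i) = iD (ee' i) by rewrite /u (unsplitK (inl i)).
have ur i : u (rshift n i) = iA (ee i) by rewrite /u (unsplitK (inr i)).
have vl i : v (lshift n i) = iA (ee i) by rewrite /v (unsplitK (inl i)).
have vr i : v (rshift n i) = - iD (ee' i) by rewrite /v (unsplitK (inr i)).
have -> : skew_canonical = \sum_k tens (u k) (v k).
  rewrite big_split_ord /= -big_split; apply: eq_bigr => i _ /=.
  by rewrite ul ur vl vr linearNr.
have -> : Al br (\sum_k tens (u k) (v k)) =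
    \sum_k \sum_l Al_summand br (u k) (v k) (u l) (v l).
  exact: AlE.
rewrite -double_sumD3 double_sum_split.
apply: eq_bigr => i _; apply: eq_bigr => j _.
rewrite !(ul, ur, vl, vr).
have baseB x y : iA x - iA y = - iA (y - x) by rewrite (linearB iA) opprB.
have oppB_opp (x y : B) : - x - - y = y - x by rewrite opprK addrC.
have brNl x y : br (- x) y = - br x y by exact: linearNl.
have brNr x y : br x (- y) = - br x y by exact: linearNr.
have -> : Al_summand br (iD (ee' i)) (iA (ee i))
    (iD (ee' j)) (iA (ee j)) =
    tens3 (iD (ee' i)) (iD (ee' j \o Rprec P (ee i))%VF) (iA (ee j))
    - tens3 (iD (ee' i)) (iD (ee' j)) (iA (ee j ≻ ee i + ee j ≺ ee i)).
  rewrite /Al_summand br_dual_dual br_commutator.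
  by rewrite br_base_base tens0l add0r.
have -> : Al_summand br (iD (ee' i)) (iA (ee i))
    (iA (ee j)) (- iD (ee' j)) = dual_base_dual i j.
  rewrite /Al_summand brNl !br_dual_base !br_base_base.
  by rewrite baseB !(tensNl, tensNr) !opprK.
have -> : Al_summand br (iA (ee i)) (- iD (ee' i))
    (iD (ee' j)) (iA (ee j)) =
    tens3 (iD (ee' j \o Lsucc P (ee i))%VF) (iD (ee' i)) (iA (ee j))
    - tens3 (iA (ee i)) (iD (ee' j)) (iD (ee' i \o Lsucc P (ee j))%VF).
  rewrite /Al_summand brNl !brNr !br_dual_dual.
  rewrite !br_base_dual !(tensNl, tensNr) !opprK.
  by rewrite oppr0 addr0 tens0l tens0r addr0.
have -> : Al_summand br (iA (ee i)) (- iD (ee' i))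
    (iA (ee j)) (- iD (ee' j)) =
    tens3 (iA (ee i ≻ ee j + ee i ≺ ee j)) (iD (ee' i)) (iD (ee' j))
    - tens3 (iA (ee i)) (iD (ee' i \o Rprec P (ee j))%VF) (iD (ee' j)).
  rewrite /Al_summand !brNl !brNr !br_dual_dual.
  rewrite oppB_opp br_commutator br_base_base.
  by rewrite !(tensNl, tensNr, tens0r, oppr0, addr0, opprK).
rewrite /dual_dual_base /base_dual_dual.
have shuffle a1 a2 a3 b c1 c2 c3 : a1 - a2 + b + (a3 - c3 + (c1 - c2)) =
    a1 - a2 + a3 + b + (c1 - c2 - c3) :> tensor B (tensor B B).
  by rewrite (AC (2*1*(2*2)) (1*2*4*3*(6*7*5))).
exact: shuffle.
Qed.

Let transp (F : 'I_n -> dual A -> A -> tensor B (tensor B B))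
    (g : 'I_n -> 'End(A)) :
  (forall i, is_bilinear (F i)) ->
  \sum_i \sum_j F i (ee' j \o g i)%VF (ee j) =
  \sum_i \sum_j F i (ee' j) (g i (ee j)).
Proof.
move=> F_bilin; apply: eq_bigr => i _.
exact: (transpose_sum e_basis e'_dual _ (F_bilin i)).
Qed.

Let iAP k x y : iA (k *: x + y) = k *: iA x + iA y.
Proof. exact: linearP. Qed.

Let iDP k x y : iD (k *: x + y) = k *: iD x + iD y.
Proof. exact: linearP. Qed.

Let tensPl (V W : vectType K) k (v v' : V) (w : W) :
  tens (k *: v + v') w = k *: tens v w + tens v' w.
Proof. exact: linearPl. Qed.

Let tensPr (V W : vectType K) k (v : V) (w w' : W) :
  tens v (k *: w + w') = k *: tens v w + tens v w'.
Proof. exact: linearPr. Qed.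

Let multilinearE := (iAP, iDP, tensPl, tensPr).

Lemma sum_dual_dual_base : \sum_i \sum_j dual_dual_base i j = 0.
Proof.
apply: (double_sum_eq0
  (F' := fun i j => tens3 (iD (ee' i)) (iD (ee' j)) (iA (ee j ≺ ee i)))
  (H' := fun i j => tens3 (iD (ee' i)) (iD (ee' j)) (iA (ee j ≻ ee i)))).
- rewrite (transp (F := fun i f x => tens3 (iD (ee' i)) (iD f) (iA x))
             (fun i => Rprec P (ee i))) => [|i].
    by apply: eq_bigr => i _; apply: eq_bigr => j _; rewrite RprecE.
  by split=> [x|x] k y z; rewrite /tens3 /= !multilinearE.
- by [].
- rewrite (transp (F := fun i f x => tens3 (iD f) (iD (ee' i)) (iA x))
             (fun i => Lsucc P (ee i))) => [|i].
    (* This term comes out with the two dual legs interchanged. *)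
    rewrite exchange_big.
    by apply: eq_bigr => i _; apply: eq_bigr => j _; rewrite LsuccE.
  by split=> [x|x] k y z; rewrite /tens3 /= !multilinearE.
move=> i j /=; rewrite /tens3 -!tensNr -!tensDr -(linearN iA) -!(linearD iA).
rewrite [X in _ - X]addrC opprD addrA subrr sub0r addNr.
by rewrite linear0 !tens0r.
Qed.

Lemma sum_dual_base_dual : \sum_i \sum_j dual_base_dual i j = 0.
Proof.
apply: (double_sum_eq0
  (F' := fun i j =>
     - tens3 (iD (ee' i)) (iA (ee i ≺ ee j - ee j ≻ ee i)) (iD (ee' j)))
  (H' := fun i j =>
     tens3 (iD (ee' i)) (iA (ee j ≺ ee i - ee i ≻ ee j)) (iD (ee' j)))).
- (* Here the transposed index is the first one. *)
  rewrite exchange_big.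
  rewrite (transp (F := fun j f x => - tens3 (iD f) (iA x) (iD (ee' j)))
             (fun j => Rprec P (ee j) - Lsucc P (ee j))) => [|j].
    rewrite exchange_big; apply: eq_bigr => i _; apply: eq_bigr => j _.
    by rewrite add_lfunE opp_lfunE RprecE LsuccE.
  by split=> [x|x] k y z; rewrite /tens3 /= !multilinearE opprD scalerN.
- by [].
- rewrite (transp (F := fun i f x => tens3 (iD (ee' i)) (iA x) (iD f))
             (fun i => Rprec P (ee i) - Lsucc P (ee i))) => [|i].
    apply: eq_bigr => i _; apply: eq_bigr => j _.
    by rewrite add_lfunE opp_lfunE RprecE LsuccE.
  by split=> [x|x] k y z; rewrite /tens3 /= !multilinearE.
move=> i j /=; rewrite /tens3 -tensNr -tensNl -!tensDr -!tensDl.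
rewrite -(linearN iA) -!(linearD iA).
(* The eight products cancel in pairs: in order, e_j ≻ e_i, e_i ≺ e_j,
   e_i ≻ e_j, e_j ≺ e_i. *)
rewrite opprB opprD (AC (2*(2*2)*2) ((1*5)*(2*4)*(3*8)*(6*7))).
by rewrite /= !subrr !addNr !addr0 linear0 tens0l tens0r.
Qed.

Lemma sum_base_dual_dual : \sum_i \sum_j base_dual_dual i j = 0.
Proof.
apply: (double_sum_eq0
  (G' := fun i j => - tens3 (iA (ee i ≺ ee j)) (iD (ee' i)) (iD (ee' j)))
  (H' := fun i j => - tens3 (iA (ee i ≻ ee j)) (iD (ee' i)) (iD (ee' j)))).
- by [].
- rewrite exchange_big.
  rewrite (transp (F := fun j f x => - tens3 (iA x) (iD f) (iD (ee' j)))
             (fun j => Rprec P (ee j))) => [|j].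
    rewrite exchange_big; apply: eq_bigr => i _; apply: eq_bigr => j _.
    by rewrite RprecE.
  by split=> [x|x] k y z; rewrite /tens3 /= !multilinearE opprD scalerN.
- rewrite exchange_big.
  rewrite (transp (F := fun j f x => - tens3 (iA x) (iD (ee' j)) (iD f))
             (fun j => Lsucc P (ee j))) => [|j].
    by apply: eq_bigr => i _; apply: eq_bigr => j _; rewrite LsuccE.
  by split=> [x|x] k y z; rewrite /tens3 /= !multilinearE opprD scalerN.
move=> i j /=; rewrite /tens3 -!tensNl -!tensDl -!(linearN iA) -!(linearD iA).
by rewrite addrK subrr linear0 tens0l.
Qed.

Lemma skew_canonical_YBE : left_alia_YBE br skew_canonical.
Proof.
rewrite /left_alia_YBE Al_skew_canonical sum_dual_dual_base.
by rewrite sum_dual_base_dual sum_base_dual_dual !addr0.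
Qed.

End Solution.

(** * The semidirect product *)

Section Canonical.
Variables (K : fieldType) (A : vectType K) (P : preLeftAlia A).

Definition in_base (x : A) : (A * dual A)%type := (x, 0).
Definition in_dual (f : dual A) : (A * dual A)%type := (0, f).

Fact in_base_linear : linear in_base.
Proof.
by move=> a x y; apply: injective_projections; rewrite /= ?scaler0 ?addr0.
Qed.

Fact in_dual_linear : linear in_dual.
Proof.
by move=> a x y; apply: injective_projections; rewrite /= ?scaler0 ?addr0.
Qed.

HB.instance Definition _ :=
  GRing.isLinear.Build K A (A * dual A)%type *:%R in_base in_base_linear.
HB.instance Definition _ :=
  GRing.isLinear.Build K (dual A) (A * dual A)%type *:%R in_dual in_dual_linear.

Lemma semidirect_base_base x y : semidirect P (in_base x) (in_base y) =
  in_base (pre_succ P x y + pre_prec P x y).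
Proof. by rewrite semidirectE !linear0 addr0. Qed.

Lemma semidirect_base_dual x f : semidirect P (in_base x) (in_dual f) =
  - in_dual (f \o Lsucc P x)%VF.
Proof.
rewrite semidirectE !linear0r !linear0 !addr0; apply: injective_projections.
  by rewrite /= oppr0.
by apply/lfunP => v; rewrite opp_lfunE comp_lfunE dual_actE.
Qed.

Lemma semidirect_dual_base f y : semidirect P (in_dual f) (in_base y) =
  in_dual (f \o (Rprec P y - Lsucc P y))%VF.
Proof.
rewrite semidirectE !linear0l !linear0 !add0r; congr pair; apply/lfunP => v.
rewrite !(add_lfunE, opp_lfunE, comp_lfunE, dual_actE).
by rewrite linearB opprK addrC.
Qed.

Lemma semidirect_dual_dual f g : semidirect P (in_dual f) (in_dual g) = 0.
Proof.
rewrite semidirectE !linear0l addr0; congr pair; apply/lfunP => v.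
rewrite !(add_lfunE, opp_lfunE, dual_actE, LsuccE, RprecE).
by rewrite !linear0l !linear0 !addr0 lfunE.
Qed.

End Canonical.

Theorem theorem6p8 (K : closedFieldType) (charK0 : [pchar K] =i pred0)
  (A : vectType K) (P : preLeftAlia A)
  (n : nat) (e : n.-tuple A) (e_basis : basis_of {:A} e)
  (e' : n.-tuple (dual A))
  (e'_dual : forall i j : 'I_n, tnth e' i (tnth e j) = (i == j)%:R) :
  let inA (x : A) : (A * dual A)%type := (x, 0) in
  let inD (f : dual A) : (A * dual A)%type := (0, f) in
  let r : tensor (A * dual A)%type (A * dual A)%type :=
    \sum_(i < n) (tens (inD (tnth e' i)) (inA (tnth e i))
                  - tens (inA (tnth e i)) (inD (tnth e' i))) in
  antisymmetric_tensor r /\ left_alia_YBE (semidirect P) r.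
Proof.
split.
  exact: (skew_canonical_antisymmetric e e' (@in_base K A) (@in_dual K A)).
apply: (skew_canonical_YBE (P := P) e_basis e'_dual (br := semidirect P)
          (iA := @in_base K A) (iD := @in_dual K A)).
- exact: semidirect_base_base.
- exact: semidirect_base_dual.
- exact: semidirect_dual_base.
- exact: semidirect_dual_dual.
Qed.
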